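(* Let $M$ be a sub-Riemannian manifold, complete as a metric space with respect to $d_{\mathrm{SR}}$, equipped with a smooth measure $\omega$, and let $p_t(x,y)$ be the heat kernel associated with the sub-Laplacian $\Delta$ and $\omega$. Let $S\subset M$ be a smooth, compact and non-characteristic submanifold of codimension $k\geq1$, let $\mu_S$ be the probability measure on $S$ induced by $\omega$, and let $r_0>0$ be a tubular radius for $S$. Define, for every $0<\varepsilon\leq r_0$, $$H_S^{\varepsilon}(t)=\int_M\int_M p_t(x,y)\,d\omega^\varepsilon(x)\,d\omega^\varepsilon(y),\qquad \forall\,t>0,$$ where $\omega^\varepsilon=\frac{1}{\omega(S_\varepsilon)}\mathds{1}_{S_\varepsilon}\omega$, and $$H_S(t)=\int_S\int_S p_t(x,y)\,d\mu_S(x)\,d\mu_S(y),\qquad\forall\,t>0.$$ Then, for every $t>0$, $$H_S^{\varepsilon}(t)\xrightarrow{\varepsilon\to0}H_S(t).$$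
   Context: Sub-Riemannian manifold: $M$ is a smooth, connected, finite-dimensional manifold equipped with global smooth vector fields $X_1,\dots,X_N$ (a generating frame). Set $\mathcal D_x=\mathrm{span}\{X_1(x),\dots,X_N(x)\}\subseteq T_xM$ (the rank may vary). The distribution is assumed bracket-generating: the Lie algebra generated by $X_1,\dots,X_N$, evaluated at $x$, is $T_xM$ for every $x\in M$. For $v\in\mathcal D_x$ put $g_x(v,v)=\inf\{\sum_{i=1}^N u_i^2\mid \sum_{i=1}^N u_iX_i(x)=v\}$, which defines an inner product on $\mathcal D_x$ by polarization, with norm $\|\cdot\|_g$. A horizontal curve is an absolutely continuous curve $\gamma\colon[0,T]\to M$ for which there is $u\in L^2([0,T],\mathbb R^N)$ with $\dot\gamma(t)=\sum_i u_i(t)X_i(\gamma(t))$ for a.e. $t$; its length is $\ell(\gamma)=\int_0^T\|\dot\gamma(t)\|_g\,dt$. The distance $d_{\mathrm{SR}}(x,y)$ is the infimum of lengths of horizontal curves joining $x$ and $y$. Smooth measure: a measure defined by a smooth positive tensor density. Heat kernel: the horizontal gradient is $\nabla f=\sum_{i=1}^N X_i(f)X_i$, the divergence $\mathrm{div}_\omega$ is defined by $\mathrm{div}_\omega(X)\,\omega=\mathcal L_X\omega$, and the sub-Laplacian is $\Delta=\mathrm{div}_\omega\circ\nabla$, i.e. $\Delta f=\sum_{i=1}^N\{X_i^2(f)+X_i(f)\,\mathrm{div}_\omega(X_i)\}$. When $(M,d_{\mathrm{SR}})$ is complete, $\Delta$ is essentially self-adjoint on $L^2(M,\omega)$ and generates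 the heat semigroup $e^{t\Delta}$; the heat kernel is the positive function $p_t(x,y)\in C^\infty((0,+\infty)\times M\times M)$ such that $e^{t\Delta}\varphi(x)=\int_M p_t(x,y)\varphi(y)\,d\omega(y)$ for $\varphi\in L^2(M,\omega)$, $t>0$. Distance from $S$ and tubular neighborhoods: $\delta_S(p)=\inf\{d_{\mathrm{SR}}(q,p)\mid q\in S\}$ and $S_\varepsilon=\{p\in M\mid 0<\delta_S(p)<\varepsilon\}$. Submanifolds are embedded and without boundary. Non-characteristic: $S$ is a non-characteristic submanifold if $\mathcal D_q+T_qS=T_qM$ for every $q\in S$. Tubular radius: a number $r_0>0$ such that $\delta_S$ is smooth on $S_{r_0}$ with $\|\nabla\delta_S\|_g=1$ and there is a diffeomorphism $G\colon(0,r_0)\times\{\delta_S=r_0\}\to S_{r_0}$ with $\delta_S(G(r,p))=r$ and $G_*\partial_r=\nabla\delta_S$. (Such an $r_0$ exists for compact non-characteristic $S$ of codimension $k\ge1$.) Induced measure $\mu_S$: the unique smooth probability measure on $S$ such that $\int_M h\,d\omega^\varepsilon\to\int_S h\,d\mu_S$ as $\varepsilon\to0$ for every $h\in C_c(M)$. (Existence and uniqueness hold for compact non-characteristic $S$ of codimension $k\ge 1$.) *)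

(* Defs.v *)
From HB Require Import structures.
From mathcomp Require Import all_boot all_order all_algebra.
From mathcomp Require Import all_classical all_reals all_analysis.

Set Implicit Arguments.
Unset Strict Implicit.
Unset Printing Implicit Defensive.

Import Order.TTheory GRing.Theory Num.Theory.
Import numFieldNormedType.Exports.

Local Open Scope classical_set_scope.
Local Open Scope ring_scope.

Section euclidean.
Context {R : realType}.

(* Meant for U open: the function ['D_v f] is total, but on U it only depends on
   the restriction of f to U. *)
Fixpoint Ck (k : nat) n (U : set 'rV[R]_n) (f : 'rV[R]_n -> R) : Prop :=
  match k with
  | 0 => forall x, U x -> {for x, continuous f}
  | k'.+1 => forall i : 'I_n,
      (forall x, U x -> derivable f x (delta_mx 0 i)) /\
      Ck k' U ('D_(delta_mx 0 i) f)
  end.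

Definition smooth_on n (U : set 'rV[R]_n) (f : 'rV[R]_n -> R) : Prop :=
  forall k, Ck k U f.

(* The inclusion of R^m as R^m x {0} in R^n (m <= n); the identity if m = n. *)
Definition pad m n (x : 'rV[R]_m) : 'rV[R]_n :=
  \row_(j < n) (if insub (val j) is Some i then x 0 i else 0).

(* The Lebesgue integral over R^m of a nonnegative measurable function, as an
   iterated integral (Tonelli); R^0 is a point of mass 1. *)
Fixpoint lebesgue_int m : ('rV[R]_m -> \bar R) -> \bar R :=
  match m with
  | 0 => fun f => f 0
  | m'.+1 => fun f =>
      (\int[@lebesgue_measure R]_t
         lebesgue_int (fun x : 'rV[R]_m' => f (row_mx t%:M x)))%E
  end.

(* A finite family of non-overlapping intervals is listed from left to
   right. *)
Definition absolutely_continuous (a b : R) (f : R -> R) : Prop :=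
  forall e, 0 < e -> exists2 d, 0 < d & forall s : seq (R * R),
    all (fun I => (a <= I.1) && (I.1 <= I.2) && (I.2 <= b)) s ->
    pairwise (fun I J => I.2 <= J.1) s ->
    \sum_(I <- s) (I.2 - I.1) < d ->
    \sum_(I <- s) `|f I.2 - f I.1| < e.

End euclidean.

(* [cmap] and [cinv] are total functions, meaningful on [dom] and on
   [cmap @` dom] respectively. *)
Record chart (R : realType) (n : nat) (T : topologicalType) := Chart {
  dom : set T;
  cmap :> T -> 'rV[R]_n;
  cinv : 'rV[R]_n -> T;
  dom_open : open dom;
  cod_open : open (cmap @` dom);
  cmapK : forall q, dom q -> cinv (cmap q) = q;
  cmap_continuous : forall q, dom q -> {for q, continuous cmap};
  cinv_continuous : forall x, (cmap @` dom) x -> {for x, continuous cinv}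
}.

Section charts.
Context {R : realType} {n : nat} {T : topologicalType}.
Implicit Types c : chart R n T.

Definition cod c : set 'rV[R]_n := c @` dom c.

Definition smooth_transition c c' : Prop := forall j : 'I_n,
  smooth_on (c @` (dom c `&` dom c')) (fun y => c' (cinv c y) 0 j).

Definition compatible c c' : Prop :=
  smooth_transition c c' /\ smooth_transition c' c.

End charts.

Record manifold (R : realType) (n : nat) := Manifold {
  carrier :> ptopologicalType;
  atlas : set (chart R n carrier);
  manifold_hausdorff : hausdorff_space carrier;
  manifold_second_countable : @second_countable carrier;
  atlas_cover : forall q : carrier, exists2 c, atlas c & dom c q;
  atlas_compatible : forall c c', atlas c -> atlas c' -> compatible c c'
}.

Section smooth.
Context {R : realType} {n : nat} {M : manifold R n}.
Implicit Types (q : M) (c : chart R n M) (S : set M) (m : nat).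

Definition is_chart c : Prop := forall c', atlas c' -> compatible c c'.

Definition smooth_at (f : M -> R) q : Prop :=
  exists2 c, is_chart c /\ dom c q &
  exists V : set 'rV[R]_n,
    [/\ open V, V (c q), V `<=` cod c & smooth_on V (f \o cinv c)].

Definition smooth_map_at a (F : 'rV[R]_a -> M) (x : 'rV[R]_a) : Prop :=
  exists2 c, is_chart c /\ dom c (F x) &
  exists V : set 'rV[R]_a,
    [/\ open V, V x, V `<=` F @^-1` dom c &
        forall j : 'I_n, smooth_on V (fun y => c (F y) 0 j)].

(* Tangent vectors at q are the derivations of the algebra of germs at q of
   smooth functions, made functions on all of M -> R by the value 0 outside
   the functions that are smooth near q. *)
Definition tangent_space q : set ((M -> R) -> R) :=
  [set v | [/\ forall f, ~ smooth_at f q -> v f = 0,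
               forall (a : R) f g, smooth_at f q -> smooth_at g q ->
                 v (fun x => a * f x + g x) = a * v f + v g &
               forall f g, smooth_at f q -> smooth_at g q ->
                 v (fun x => f x * g x) = v f * g q + f q * v g]].

Definition velocity (gamma : R -> M) (t : R) : (M -> R) -> R :=
  fun f => if `[< smooth_at f (gamma t) >] then derive1 (f \o gamma) t else 0.

Definition differentiable_curve_at (gamma : R -> M) (t : R) : Prop :=
  forall f, smooth_at f (gamma t) -> derivable (f \o gamma) t 1.

Definition vector_field := M -> (M -> R) -> R.

Definition smooth_vector_field (X : vector_field) : Prop :=
  forall q, tangent_space q (X q) /\
    forall f, smooth_at f q -> smooth_at (fun x => X x f) q.

Definition lie_bracket (X Y : vector_field) : vector_field :=
  fun q f => if `[< smooth_at f q >]
    then X q (fun x => Y x f) - Y q (fun x => X x f) else 0.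

Inductive lie_algebra (F : set vector_field) : set vector_field :=
| lie_gen X : F X -> lie_algebra F X
| lie_zero : lie_algebra F (fun _ _ => 0)
| lie_add X Y : lie_algebra F X -> lie_algebra F Y ->
    lie_algebra F (fun q => X q + Y q)
| lie_scale (a : R) X : lie_algebra F X -> lie_algebra F (fun q => a *: X q)
| lie_brack X Y : lie_algebra F X -> lie_algebra F Y ->
    lie_algebra F (lie_bracket X Y).

Definition slice_chart m S c : Prop :=
  is_chart c /\
  c @` (dom c `&` S) =
    cod c `&` [set x | forall j : 'I_n, (m <= j)%N -> x 0 j = 0].

Definition embedded_submanifold m S : Prop :=
  (m <= n)%N /\ forall q, S q -> exists2 c, slice_chart m S c & dom c q.

(* T_q S as a subspace of T_q M: the velocities of the smooth curves in S. *)
Definition submanifold_tangent S q : set ((M -> R) -> R) :=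
  [set v | exists gamma : R -> M,
    [/\ forall t, S (gamma t), gamma 0 = q,
        forall x : 'rV[R]_1, smooth_map_at (fun y => gamma (y 0 0)) x &
        v = velocity gamma 0]].

Definition borel := g_sigma_algebraType (@open M).

(* In a slice chart of the m-dimensional submanifold S, with coordinates x in
   R^m, the measure is rho(x) dx. *)
Definition has_density m S (mu : set borel -> \bar R) c
    (rho : 'rV[R]_m -> R) : Prop :=
  let W := [set x : 'rV[R]_m | cod c (pad n x)] in
  [/\ smooth_on W rho, forall x, W x -> 0 < rho x &
      forall B : set borel, measurable B -> B `<=` dom c ->
        mu (B `&` S) = lebesgue_int (fun x =>
          (\1_(W `&` [set x | B (cinv c (pad n x))]) x * rho x)%:E)].

(* A smooth measure on S, seen as a measure on M concentrated on S. *)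
Definition smooth_measure m S (mu : set borel -> \bar R) : Prop :=
  mu (~` S) = 0%E /\
  forall c, slice_chart m S c ->
    exists rho : 'rV[R]_m -> R, has_density S mu c rho.

(* If omega = rho dx in a chart, then the Lie derivative of omega along X is
   (\sum_j d_j (rho X^j)) dx, where X^j is the value of X on the j-th
   coordinate function. *)
Definition lie_derivative_density (X : vector_field) c
    (rho : 'rV[R]_n -> R) (x : 'rV[R]_n) : R :=
  \sum_(j < n) 'D_(delta_mx 0 j)
    (fun y => rho y * X (cinv c y) (fun q => c q 0 j)) x.

Definition divergence (omega : set borel -> \bar R) (X : vector_field) q : R :=
  xget 0 [set d | forall c (rho : 'rV[R]_n -> R),
    is_chart c -> dom c q ->
    has_density setT omega c rho ->
    d * rho (c q) = lie_derivative_density X c rho (c q)].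

Definition compact_support (f : M -> R) : Prop :=
  compact (closure [set q | f q != 0]).

End smooth.

Arguments vector_field {R n} M.
Arguments borel {R n} M.

Section sub_riemannian.
Context {R : realType} {n N : nat} {M : manifold R n}.
Variable X : 'I_N -> vector_field M.
Implicit Types (q : M) (S : set M) (gamma : R -> M) (T : R).

Definition bracket_generating : Prop :=
  forall q v, tangent_space q v ->
    exists2 Y : vector_field M, lie_algebra (range X) Y & Y q = v.

Definition distribution q : set ((M -> R) -> R) :=
  [set v | exists u : 'I_N -> R, v = \sum_i u i *: X i q].

(* Meaningful for v in the distribution at q. *)
Definition sr_norm q (v : (M -> R) -> R) : R :=
  Num.sqrt (inf [set \sum_i (u i) ^+ 2 | u in
    [set u : 'I_N -> R | \sum_i u i *: X i q = v]]).

Definition absolutely_continuous_curve T gamma : Prop :=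
  {within `[0, T], continuous gamma} /\
  forall a b (c : chart R n M), 0 <= a -> a <= b -> b <= T -> is_chart c ->
    gamma @` `[a, b] `<=` dom c ->
    forall j : 'I_n, absolutely_continuous a b (fun t => c (gamma t) 0 j).

Definition horizontal T gamma : Prop :=
  absolutely_continuous_curve T gamma /\
  exists u : 'I_N -> R -> R,
    (forall i, measurable_fun `[0, T] (u i) /\
       (\int[lebesgue_measure]_(t in `[0%R, T]) ((u i t) ^+ 2)%:E < +oo)%E) /\
    {ae lebesgue_measure, forall t, t \in `[0, T] ->
       differentiable_curve_at gamma t /\
       velocity gamma t = \sum_i u i t *: X i (gamma t)}.

Definition sr_length T gamma : \bar R :=
  (\int[lebesgue_measure]_(t in `[0%R, T])
     (sr_norm (gamma t) (velocity gamma t))%:E)%E.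

Definition sr_dist q q' : \bar R :=
  ereal_inf [set l | exists T gamma,
    [/\ 0 <= T, horizontal T gamma, gamma 0 = q, gamma T = q' &
        l = sr_length T gamma]].

Definition sr_complete : Prop :=
  forall x : nat -> M,
    (forall e, 0 < e -> exists K, forall i j, (K <= i)%N -> (K <= j)%N ->
      (sr_dist (x i) (x j) < e%:E)%E) ->
    exists l, sr_dist (x i) l @[i --> \oo] --> 0%E.

Definition dist_from S q : \bar R :=
  ereal_inf [set sr_dist s q | s in S].

Definition tube S (e : R) : set M :=
  [set q | (0 < dist_from S q)%E /\ (dist_from S q < e%:E)%E].

Definition noncharacteristic S : Prop :=
  forall q, S q -> forall v, tangent_space q v ->
    exists w z, [/\ distribution q w, submanifold_tangent S q z & v = w + z].

Definition gradient (f : M -> R) : vector_field M :=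
  fun q => \sum_i X i q f *: X i q.

(* The inverse of the diffeomorphism G is y |-> (delta_S y, pr y). *)
Definition tubular_radius S (r0 : R) : Prop :=
  let delta q := fine (dist_from S q) in
  let L := [set q | dist_from S q = r0%:E] in
  [/\ 0 < r0,
      forall q, tube S r0 q ->
        smooth_at delta q /\ sr_norm q (gradient delta q) = 1,
      embedded_submanifold n.-1 L &
      exists (G : R -> M -> M) (pr : M -> M),
        [/\ forall r q, 0 < r < r0 -> L q ->
              [/\ tube S r0 (G r q), dist_from S (G r q) = r%:E &
                  pr (G r q) = q],
            forall y, tube S r0 y -> L (pr y) /\ G (delta y) (pr y) = y,
            forall (c : chart R n M) (z : 'rV[R]_(1 + n.-1)),
              slice_chart n.-1 L c -> 0 < z 0 0 < r0 ->
              cod c (pad n (rsubmx z)) ->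
              smooth_map_at
                (fun w : 'rV[R]_(1 + n.-1) =>
                   G (w 0 0) (cinv c (pad n (rsubmx w)))) z,
            forall (c : chart R n M) y, is_chart c -> tube S r0 y -> dom c y ->
              smooth_map_at (pr \o cinv c) (c y) &
            forall r q, 0 < r < r0 -> L q ->
              differentiable_curve_at (G^~ q) r /\
              velocity (G^~ q) r = gradient delta (G r q)]].

Section heat.
Variable omega : {measure set (borel M) -> \bar R}.

Definition sub_laplacian (f : M -> R) : M -> R :=
  divergence omega (gradient f).

Definition L2 : set (borel M -> R) := [set f | f \in Lfun omega 2%:E].

Definition L2norm (f : borel M -> R) : \bar R := Lnorm omega 2%:E (EFin \o f).

Definition test_function (f : M -> R) : Prop :=
  (forall q, smooth_at f q) /\ compact_support f.

(* The graph of the closure in L^2 of the sub-Laplacian on C_c^oo(M), which is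
   self-adjoint when the sub-Laplacian is essentially self-adjoint. *)
Definition sub_laplacian_closure (f g : borel M -> R) : Prop :=
  [/\ L2 f, L2 g &
      exists phi : nat -> M -> R,
        [/\ forall i, test_function (phi i),
            L2norm (fun x => phi i x - f x) @[i --> \oo] --> 0%E &
            L2norm (fun x => sub_laplacian (phi i) x - g x) @[i --> \oo]
              --> 0%E]].

Definition in_generator (P : R -> (borel M -> R) -> (borel M -> R))
    (f g : borel M -> R) : Prop :=
  [/\ L2 f, L2 g &
      L2norm (fun x => t^-1 * (P t f x - f x) - g x) @[t --> 0^'+] --> 0%E].

(* P is (a choice of representatives of) the strongly continuous semigroup on
   L^2(M, omega) generated by the closure of the sub-Laplacian. *)
Definition heat_semigroup (P : R -> (borel M -> R) -> (borel M -> R)) : Prop :=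
  [/\ forall t, 0 <= t ->
        [/\ forall f, L2 f -> L2 (P t f),
            forall (a : R) f g, L2 f -> L2 g ->
              {ae omega, forall x,
                P t (fun x => a * f x + g x) x = a * P t f x + P t g x} &
            exists C : R, forall f, L2 f ->
              (L2norm (P t f) <= C%:E * L2norm f)%E],
      forall f, L2 f -> {ae omega, forall x, P 0 f x = f x},
      forall s t f, 0 <= s -> 0 <= t -> L2 f ->
        {ae omega, forall x, P (s + t) f x = P s (P t f) x},
      forall f, L2 f -> L2norm (fun x => P t f x - f x) @[t --> 0^'+] --> 0%E &
      forall f g, in_generator P f g <-> sub_laplacian_closure f g].

Definition smooth_kernel (p : R -> M -> M -> R) : Prop :=
  forall c c' : chart R n M, is_chart c -> is_chart c' ->
    smooth_on
      [set z : 'rV[R]_(1 + (n + n)) | [/\ 0 < z 0 0,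
         cod c (lsubmx (rsubmx z)) & cod c' (rsubmx (rsubmx z))]]
      (fun z : 'rV[R]_(1 + (n + n)) => p (z 0 0)
         (cinv c (lsubmx (rsubmx z))) (cinv c' (rsubmx (rsubmx z)))).

Definition heat_kernel (p : R -> M -> M -> R) : Prop :=
  [/\ forall t x y, 0 < t -> 0 < p t x y,
      smooth_kernel p &
      exists2 P, heat_semigroup P &
        forall t phi, 0 < t -> L2 phi ->
          {ae omega, forall x : borel M,
            ((P t phi x)%:E = \int[omega]_y (p t x y * phi y)%:E)%E}].

Definition tube_measure S (e : R) (A : set (borel M)) : \bar R :=
  (((fine (omega (tube S e)))^-1)%:E * omega (A `&` tube S e))%E.

Definition induced_measure m S (mu : probability (borel M) R) : Prop :=
  smooth_measure m S mu /\
  forall h : M -> R, continuous h -> compact_support h ->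
    (\int[tube_measure S e]_x (h x)%:E)%E @[e --> 0^'+] -->
    (\int[mu]_(x in S) (h x)%:E)%E.

Definition H_tube S (p : R -> M -> M -> R) (e t : R) : \bar R :=
  (\int[tube_measure S e]_y \int[tube_measure S e]_x (p t x y)%:E)%E.

End heat.

Definition H_limit S (mu : probability (borel M) R) (p : R -> M -> M -> R)
    (t : R) : \bar R :=
  (\int[mu]_(y in S) \int[mu]_(x in S) (p t x y)%:E)%E.

End sub_riemannian.

(* Main.v *)
Require Import Defs.
From HB Require Import structures.
From mathcomp Require Import all_boot all_order all_algebra.
From mathcomp Require Import all_classical all_reals all_analysis.
From mathcomp Require Import measurable_realfun lra.

Set Implicit Arguments.
Unset Strict Implicit.
Unset Printing Implicit Defensive.

Import Order.TTheory GRing.Theory Num.Theory.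
Import numFieldNormedType.Exports.

Local Open Scope classical_set_scope.
Local Open Scope ring_scope.

(** Only the continuity of the heat kernel at fixed time is used.  Along a
    horizontal curve a chart coordinate is absolutely continuous, with derivative
    bounded by a constant times the norm of the velocity, so short curves issued
    from a small chart ball stay in a bigger one; since S is compact, the tubes
    around S eventually lie in a fixed compact set K carrying a cutoff function.
    Hence the normalized tube measures have mass at most 1, are concentrated on
    K and converge to mu_S against every continuous function.  Equicontinuity of
    the kernel on K makes the potentials y |-> int p_t(x, y) d nu(x) of such
    measures uniformly equicontinuous, so they converge uniformly on K, and the
    double integrals converge. *)

(** * Absolutely continuous functions *)

(** The supremum of the points [x] with [P a x] must be [b]: otherwise an interval around it,
    supplied by the local hypothesis, carries the property past it. *)
Lemma cousin (R : realType) (P : R -> R -> Prop) (a b : R) : a <= b ->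
    (forall u v w, u <= v -> v <= w -> P u v -> P v w -> P u w) ->
    (forall x, a <= x <= b -> exists2 d, 0 < d &
      forall u v, a <= u -> u <= x -> x <= v -> v <= b -> v - u < d -> P u v) ->
  P a b.
Proof.
move=> ab Ptrans Ploc.
pose A := [set x | a <= x <= b /\ P a x].
have Aa : A a.
  split; first by rewrite lexx.
  have [|d d0] := Ploc a; first by rewrite lexx.
  by apply=> //; rewrite subrr.
have ubA : ubound A b by move=> x [/andP[]].
have hsA : has_sup A by split; [exists a|exists b].
have as_ : a <= sup A by apply: sup_upper_bound.
have sb : sup A <= b by apply: ge_sup => //; exists a.
have [|d d0 Pd] := Ploc (sup A); first by rewrite as_.
have d3 : 0 < d / 3 by rewrite divr_gt0.
have [x [/andP[ax xb] Pax] sx] := sup_adherent d3 hsA.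
have xs : x <= sup A by apply: sup_upper_bound => //; split; rewrite ?ax.
(* The point [x] lies less than [d / 3] below the supremum and [v] at most [d / 3] above it, so
   [v - x < d]. *)
pose v := Num.min b (sup A + d / 3).
have sv : sup A <= v by rewrite le_min sb; lra.
have vb : v <= b by rewrite ge_min lexx.
have vd : v <= sup A + d / 3 by rewrite ge_min lexx orbT.
have Pav : P a v.
  by apply: (Ptrans _ x) => //; [lra|apply: Pd => //; lra].
have vs : v <= sup A.
  by apply: sup_upper_bound => //; split=> //; rewrite vb andbT; lra.
have [bv|vb'] := leP b v; first by have <- : v = b by apply/le_anti; rewrite vb.
move: vb' vs; rewrite /v minEle; case: ifPn => _; lra.
Qed.

Section ac_increment.
Context {R : realType}.
Local Notation mu := (@lebesgue_measure R).

(** The difference quotients near [x] exceed [- e] on both sides, and the increments from [u] to [x]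
    and from [x] to [v] add up. This is the local input for Cousin's lemma. *)
Lemma derivable_increment_ge (h : R -> R) (x e : R) :
    derivable h x 1 -> 0 <= derive1 h x -> 0 < e ->
  exists2 d, 0 < d & forall u v, u <= x -> x <= v -> v - u < d ->
    - e * (v - u) <= h v - h u.
Proof.
move=> dh h0 e0.
have /cvgrPdist_lt /(_ e e0) :
    z^-1 *: (h (z + x) - h x) @[z --> 0^'] --> derive1 h x.
  have -> : (fun z => z^-1 *: (h (z + x) - h x)) =
      (fun z => z^-1 *: ((h \o shift x) (z *: 1) - h x)).
    by apply/funext => z /=; rewrite /GRing.scale/= mulr1.
  by rewrite derive1E; exact: dh.
rewrite near_withinE => /nbhs_ballP[d /= d0 dP].
have loc z : `|z| < d -> z != 0 -> - e < z^-1 * (h (z + x) - h x).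
  move=> zd z0; have := dP z; rewrite /ball/= sub0r normrN => /(_ zd z0).
  by rewrite ltr_norml => /andP[_]; rewrite /GRing.scale/=; lra.
exists d => // u v ux xv vud.
have hv : - e * (v - x) <= h v - h x.
  have [->|vx] := eqVneq v x; first by lra.
  have vx0 : 0 < v - x by rewrite subr_gt0 lt_neqAle eq_sym vx.
  have := loc (v - x); rewrite gt_eqF// gtr0_norm// subrK mulrC.
  have -> : v - x < d by lra.
  by move=> /(_ isT isT); rewrite ltr_pdivlMr// => /ltW.
have hu : - e * (x - u) <= h x - h u.
  have [->|ux'] := eqVneq u x; first by lra.
  have ux0 : 0 < x - u by rewrite subr_gt0 lt_neqAle ux'.
  have ud : `|u - x| < d by rewrite distrC gtr0_norm//; lra.
  have un : u - x != 0 by rewrite subr_eq0.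
  have := loc _ ud un; rewrite subrK -(opprB x u) invrN mulNr mulrC -mulNr.
  by rewrite ltr_pdivlMr//; lra.
by lra.
Qed.

Lemma derive1B_ge0 (f F : R -> R) (x : R) :
    derivable f x 1 -> derivable F x 1 -> derive1 f x <= derive1 F x ->
  derivable (F - f) x 1 /\ 0 <= derive1 (F - f) x.
Proof.
move=> df dF fF; split; first exact: derivableB.
by rewrite derive1E deriveB// -!derive1E subr_ge0.
Qed.

(* [P u v] below records, besides the inequality up to [eta * (v - u)], the
   variation of [f] over disjoint intervals of [`[u, v]] contained in an open
   set [U] of small measure.  These intervals absorb the null set where the
   derivatives misbehave, and Cousin's lemma glues the local statements. *)
Lemma ac_increment_le_sub (a b : R) (f g : R -> R) : a <= b ->
    absolutely_continuous a b f ->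
    mu.-integrable setT (EFin \o g) -> (forall x, 0 <= g x) ->
    {ae mu, forall x, x \in `[a, b] -> derivable f x 1 /\ derive1 f x <= g x} ->
  f b - f a <= \int[mu]_(x in `]a, b]) g x.
Proof.
move=> ab acf ig g0 dfg.
pose F x := (\int[mu]_(t in `]-oo, x]) g t)%R.
have iF x : mu.-integrable `]-oo, x] (EFin \o g).
  by apply: integrableS ig.
have Fab u v : u <= v -> F v - F u = (\int[mu]_(t in `]u, v]) g t)%R.
  by move=> uv; rewrite /F Rintegral_itvB.
have F_nd u v : u <= v -> F u <= F v.
  by move=> uv; rewrite -subr_ge0 Fab// Rintegral_ge0.
rewrite -Fab//.
have dF : {ae mu, forall x, derivable F x 1 /\ derive1 F x = g x}.
  apply: FTC1Ny => //.
  by apply: open_integrable_locally => //; exact: openT.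
have [Z [mZ Z0 ZP]] : mu.-negligible [set x | ~ (x \in `[a, b] ->
    (derivable f x 1 /\ derive1 f x <= g x) /\
    (derivable F x 1 /\ derive1 F x = g x))].
  apply: filterS2 dfg dF; first exact: (ae_filter_ringOfSetsType mu).
  by move=> x h1 h2 xab; split=> //; exact: h1.
clearbody F.
apply/ler_addgt0Pr => e e0.
have e2 : 0 < e / 2 by rewrite divr_gt0.
have [d d0 acd] := acf _ e2.

have muZ : (mu Z < +oo)%E by rewrite Z0.
(* Outer regularity encloses the null set in an open [U] of measure below the [d] that absolute
   continuity attaches to [e / 2]. *)
have [U [oU ZU UZd]] := lebesgue_regularity_outer mZ muZ d0.
have mU : measurable U by exact: open_measurable.
have Ud : (mu U < d%:E)%E.
  have UZ0 : mu (U `&` Z) = 0%E.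
    by apply: (subset_measure0 _ mZ) => //; exact: measurableI.
  have UE : (mu U = mu (U `\` Z) + mu (U `&` Z))%E by exact: measureDI.
  by apply: le_lt_trans UZd; rewrite UE UZ0 adde0.
(* The other half of [e] pays for [eta * (b - a)]; the [+ 1] keeps the denominator positive when
   [a = b]. *)
have eb : 0 < e / (2 * (b - a + 1)) by rewrite divr_gt0// mulr_gt0//; lra.
set eta := e / _ in eb.
pose P u v := exists s : seq (R * R), [/\
  all (fun I => (u <= I.1) && (I.1 <= I.2) && (I.2 <= v)) s,
  pairwise (fun I J => I.2 <= J.1) s,
  ((\sum_(I <- s) (I.2 - I.1))%:E <= mu (U `&` `]u, v]))%E &
  f v - f u <= F v - F u + eta * (v - u) + \sum_(I <- s) `|f I.2 - f I.1|].
suff [s [s1 s2 s3 s4]] : P a b.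
  have : \sum_(I <- s) `|f I.2 - f I.1| < e / 2.
    apply: acd => //; rewrite -lte_fin (le_lt_trans s3)// (le_lt_trans _ Ud)//.
    by apply: le_measure; rewrite ?inE//; apply: measurableI.
  suff : eta * (b - a) <= e / 2 by lra.
  rewrite /eta invfM mulrA -mulrA ler_piMr//; first lra.
  by rewrite mulrC ler_pdivrMr; lra.
apply: cousin => //.
- move=> u v w uv vw [s [s1 s2 s3 s4]] [r [r1 r2 r3 r4]].
  exists (s ++ r); split.
  + rewrite all_cat; apply/andP; split.
      apply: sub_all s1 => I /andP[-> /=] Iv; exact: (le_trans Iv).
    by apply: sub_all r1 => I /andP[/andP[vI -> ->]]; rewrite (le_trans uv).
  + rewrite pairwise_cat s2 r2 !andbT; apply/allrelP => I J Is Jr.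
    move/allP : s1 => /(_ _ Is)/andP[_ Iv].
    by move/allP : r1 => /(_ _ Jr)/andP[/andP[vJ _] _]; exact: (le_trans Iv).
  + rewrite big_cat EFinD/=.
    have -> : U `&` `]u, w] = (U `&` `]u, v]) `|` (U `&` `]v, w]).
      by rewrite -setIUr -itv_bndbnd_setU.
    rewrite measureU//; first exact: leeD.
    * by apply: measurableI.
    * by apply: measurableI.
    * rewrite -subset0 => x /= [[_]]; rewrite in_itv/= => /andP[_ xv] [_].
      by rewrite in_itv/= => /andP[+ _]; rewrite ltNge xv.
  + by rewrite big_cat/=; lra.
- move=> x xab.
  (* Around a bad point the whole interval lies in [U] and is the only entry of the list: its
     variation term covers the increment of [f]. *)
  have [Zx|nZx] := pselect (Z x).
    have /nbhs_ballP[r /= r0 rU] : nbhs x U.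
      by apply: open_nbhs_nbhs; split => //; exact: ZU.
    exists r => // u v au ux xv vb vur; exists [:: (u, v)]; split => /=.
    + by rewrite !lexx (le_trans ux).
    + by [].
    + rewrite big_seq1/= setIidr; last first.
        move=> y /=; rewrite in_itv/= => /andP[uy yv]; apply: rU.
        by rewrite /ball/= ltr_norml; apply/andP; split; lra.
      rewrite lebesgue_measure_itv/= lte_fin; case: ifPn; first by rewrite EFinB.
      by rewrite -leNgt => vu; rewrite lee_fin; lra.
    + rewrite big_seq1/=; have := F_nd u v (le_trans ux xv).
      have := ler_norm (f v - f u).
      have : 0 <= eta * (v - u) by rewrite mulr_ge0//; lra.
      lra.
  (* At a good point [F - f] has a nonnegative derivative, so the empty list and the slack [eta]
     suffice. *)
  have [[df fg] [dFx Fg]] : (derivable f x 1 /\ derive1 f x <= g x) /\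
      (derivable F x 1 /\ derive1 F x = g x).
    by apply: contrapT => h; apply: nZx; apply: ZP => /= h'; apply: h; exact: h'.
  have [dh h0] : derivable (F - f) x 1 /\ 0 <= derive1 (F - f) x.
    by apply: derive1B_ge0; rewrite ?Fg.
  have [r r0 rP] := derivable_increment_ge dh h0 eb.
  exists r => // u v au ux xv vb vur; exists [::]; split => //.
    by rewrite big_nil.
  rewrite big_nil.
  have : - eta * (v - u) <= (F v - f v) - (F u - f u) := rP _ _ ux xv vur.
  by lra.
Qed.

Lemma absolutely_continuousN (a b : R) (f : R -> R) :
  absolutely_continuous a b f -> absolutely_continuous a b (fun x => - f x).
Proof.
move=> acf e /acf[d d0 dP]; exists d => // s s1 s2 s3.
under eq_bigr do rewrite opprK addrC distrC.
exact: dP.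
Qed.

(** The one-sided bound is applied to [f] and to [- f], with [g] extended by zero outside the
    interval; if the integral is infinite the bound is trivial. *)
Lemma ac_increment_le (a b : R) (f g : R -> R) : a <= b ->
    absolutely_continuous a b f ->
    measurable_fun `[a, b] g -> (forall x, 0 <= g x) ->
    {ae mu, forall x, x \in `[a, b] ->
      derivable f x 1 /\ `|derive1 f x| <= g x} ->
  (`|f b - f a|%:E <= \int[mu]_(x in `[a, b]) (g x)%:E)%E.
Proof.
move=> ab acf mg g0 dfg.
have mitv (u v : R) : measurable (`]u, v] : set R) by [].
have [->|/eqP ioo] := eqVneq (\int[mu]_(x in `[a, b]) (g x)%:E)%E +oo%E.
  by rewrite leey.
have ig : mu.-integrable `[a, b] (EFin \o g).
  apply/integrableP; split; first exact/measurable_EFinP.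
  under eq_integral do rewrite /= ger0_norm//.
  by rewrite ltey; apply/eqP.
pose h := g \_ `[a, b].
have h0 x : 0 <= h x by rewrite /h patchE; case: ifP.
have ih : mu.-integrable setT (EFin \o h).
  by rewrite /h -restrict_EFin -integrable_mkcond.
have hg x : x \in `[a, b] -> h x = g x.
  by move=> xab; rewrite /h patchE mem_set.
have -> : (\int[mu]_(x in `[a, b]) (g x)%:E)%E =
    (\int[mu]_(x in `]a, b]) h x)%:E.
  have ihab : mu.-integrable `]a, b] (EFin \o h) by apply: integrableS ih.
  rewrite (Rintegral_itv_obnd_cbnd ihab).
  under eq_Rintegral => x do [rewrite inE => /hg ->].
  by rewrite /Rintegral fineK// integrable_fin_num.
have dh (F : R -> R) :
    (forall x, derivable f x 1 ->
      derivable F x 1 /\ derive1 F x <= `|derive1 f x|) ->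
   {ae mu, forall x, x \in `[a, b] -> derivable F x 1 /\ derive1 F x <= h x}.
  move=> FP; apply: filterS dfg; first exact: (ae_filter_ringOfSetsType mu).
  move=> x fg xab; have [dfx fgx] := fg xab; have [dFx Fx] := FP x dfx.
  by split=> //; rewrite hg// (le_trans Fx).
rewrite lee_fin ler_norml; apply/andP; split.
  have /= := ac_increment_le_sub ab (absolutely_continuousN acf) ih h0.
  rewrite lerNl opprB opprK addrC; apply; apply: dh => // x dfx.
  split; first exact: derivableN.
  by rewrite derive1E deriveN// -derive1E ler_normr lexx orbT.
apply: ac_increment_le_sub => //; apply: dh => // x dfx.
by split=> //; exact: ler_norm.
Qed.

End ac_increment.

(** * Charts *)

Section chart_functions.
Context {R : realType}.

Lemma near_eq_continuous (T U : topologicalType) (f g : T -> U) (x : T) :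
  {near x, f =1 g} -> {for x, continuous f} -> {for x, continuous g}.
Proof.
move=> fg cf; rewrite /prop_for/= /continuous_at -(nbhs_singleton fg).
exact: cvg_trans (near_eq_cvg fg) cf.
Qed.

(** Partial derivatives on an open set see only the germ of the function. Chart expressions call for
    this, as [c (cinv c y) = y] holds only on [cod c]. *)
Lemma Ck_ext k n (U : set 'rV[R]_n) (f g : 'rV[R]_n -> R) :
  open U -> (forall x, U x -> f x = g x) -> Ck k U f -> Ck k U g.
Proof.
move=> oU; elim: k f g => [|k IH] f g fg.
  move=> cf x Ux; apply: near_eq_continuous (cf x Ux).
  by apply: filterS fg _; exact: open_nbhs_nbhs.
have fgn x : U x -> {near x, f =1 g}.
  by move=> Ux; apply: filterS fg _; exact: open_nbhs_nbhs.
move=> Cf i; have [df Cdf] := Cf i; split.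
  by move=> x Ux; apply: near_eq_derivable (df x Ux); exact: fgn.
by apply: IH Cdf => x Ux; apply: near_eq_derive; exact: fgn.
Qed.

Lemma Ck_cst k n (U : set 'rV[R]_n) (a : R) : Ck k U (fun=> a).
Proof.
elim: k a => [|k IH] a /=; first by move=> x _; exact: cst_continuous.
move=> i; split; first by move=> x _; exact: derivable_cst.
have -> : 'D_(delta_mx 0 i) (fun _ : 'rV[R]_n => a) = fun=> 0.
  by apply/funext => x; exact: derive_cst.
exact: IH.
Qed.

Lemma is_derive_coord n (j : 'I_n) (x v : 'rV[R]_n) :
  is_derive x v (fun y : 'rV[R]_n => y 0 j) (v 0 j).
Proof.
pose q (h : R) := h^-1 *: ((fun y : 'rV[R]_n => y 0 j) (h *: v + x) - x 0 j).
have cv : q h @[h --> 0^'] --> v 0 j.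
  have qE : {near 0^', (fun=> v 0 j) =1 q}.
    near=> h; rewrite /q !mxE addrK /GRing.scale/= mulKf//.
    by near: h; exact: nbhs_dnbhs_neq.
  exact: cvg_trans (near_eq_cvg qE) (cvg_cst _).
split; first exact: cvgP cv.
by apply/cvg_lim => //; exact: Rhausdorff.
Unshelve. all: by end_near. Qed.

Lemma smooth_on_coord n (U : set 'rV[R]_n) (j : 'I_n) :
  smooth_on U (fun y => y 0 j).
Proof.
case=> [|k] /=; first by move=> x _; exact: coord_continuous.
move=> i; split.
  by move=> x _; have [] := is_derive_coord j x (delta_mx 0 i).
have -> : 'D_(delta_mx 0 i) (fun y : 'rV[R]_n => y 0 j) =
    fun=> (delta_mx 0 i : 'rV[R]_n) 0 j.
  by apply/funext => x; have [] := is_derive_coord j x (delta_mx 0 i).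
exact: Ck_cst.
Qed.

(** The norm is the sup norm, attained at an entry; [0 < r] excludes the empty row. *)
Lemma norm_coord_ge n (y : 'rV[R]_n) (r : R) : 0 < r -> r <= `|y| ->
  exists j, r <= `|y 0 j|.
Proof.
move=> r0 ry; have y0 : mx_norm y != 0.
  by apply: lt0r_neq0; exact: lt_le_trans ry.
have [[i j] /= yij] := mx_norm_neq0 y0.
by exists j; move: ry; rewrite /Num.norm/= yij (ord1 i).
Qed.

Lemma compact_ball_rV n (y0 : 'rV[R]_n) (r : R) : 0 < r ->
  compact [set y | `|y0 - y| <= r].
Proof.
move=> r0; apply: bounded_closed_compact.
  exists (`|y0| + r); split; first exact: num_real.
  move=> z zr y /= yr; rewrite -(subKr y0 y) (le_trans (ler_normB _ _))//.
  by rewrite (le_trans _ (ltW zr))// lerD2l.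
have -> : [set y | `|y0 - y| <= r] = closed_ball y0 r by rewrite closed_ballE.
exact: closed_ball_closed.
Qed.

Context {n : nat} {M : manifold R n}.
Implicit Types (q s : M) (c : chart R n M).

Lemma atlas_is_chart c : atlas c -> is_chart c.
Proof. by move=> ac c' ac'; exact: atlas_compatible. Qed.

Lemma cinvK c y : cod c y -> dom c (cinv c y) /\ c (cinv c y) = y.
Proof. by move=> [q dq <-]; rewrite cmapK. Qed.

Lemma smooth_at_coord c q (j : 'I_n) : is_chart c -> dom c q ->
  smooth_at (fun x => c x 0 j) q.
Proof.
move=> cc dq; exists c => //; exists (cod c); split => //.
- exact: cod_open.
- by exists q.
- move=> k; apply: (@Ck_ext k n _ (fun y => y 0 j)); first exact: cod_open.
    by move=> y /cinvK[_ /= ->].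
  exact: smooth_on_coord.
Qed.

Lemma smooth_at_continuous (f : M -> R) q :
  smooth_at f q -> {for q, continuous f}.
Proof.
move=> [c [cc dq] [V [oV Vq Vc sV]]].
apply: (@near_eq_continuous _ _ ((f \o cinv c) \o c)).
  apply: (@filterS _ _ _ (dom c)); first by move=> x dx /=; rewrite cmapK.
  by apply: open_nbhs_nbhs; split => //; exact: dom_open.
apply: continuous_comp; first exact: cmap_continuous.
exact: sV 0 (c q) Vq.
Qed.

End chart_functions.

(** * Horizontal curves *)

(* No measurability is needed, the integral of a nonnegative function being a
   supremum over simple functions below it; the norm of the velocity of a
   horizontal curve is not known to be measurable in time. *)
Lemma ge0_le_lower_integral d (T : measurableType d) (R : realType)
    (mu : {measure set T -> \bar R}) (D E : set T) (f g : T -> \bar R) :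
    D `<=` E -> (forall x, D x -> 0 <= f x)%E -> (forall x, E x -> 0 <= g x)%E ->
    (forall x, D x -> f x <= g x)%E ->
  (\int[mu]_(x in D) f x <= \int[mu]_(x in E) g x)%E.
Proof.
move=> DE f0 g0 fg; rewrite !ge0_integralE//.
apply: ereal_sup_le => _ [h hf <-]; exists h => // x.
apply: le_trans (hf x) _; rewrite !patchE.
case: ifPn => [|_].
  by rewrite inE => Dx; rewrite mem_set ?fg//; exact: DE.
by case: ifPn => //; rewrite inE; exact: g0.
Qed.

Section horizontal_curves.
Context {R : realType} {n N : nat} {M : manifold R n}.
Variable X : 'I_N -> vector_field M.
Hypothesis X_smooth : forall i, smooth_vector_field (X i).
Local Notation mu := (@lebesgue_measure R).

(** Each control [u] of [v] gives a bound by [B * N] times its Euclidean norm, and the infimum runs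
    over a nonempty set since [v] is in the distribution. The factor [N.+1] keeps the constant
    positive when [N = 0]. *)
Lemma sr_norm_ge q (v : (M -> R) -> R) (f : M -> R) (B : R) : 0 < B ->
    Defs.distribution X q v -> (forall i, `|X i q f| <= B) ->
  `|v f| <= B * N.+1%:R * sr_norm X q v.
Proof.
move=> B0 [u0 vu0] XB.
have C0 : 0 < B * N.+1%:R by rewrite mulr_gt0// ltr0n.
rewrite mulrC -ler_pdivrMr// /sr_norm -(@ger0_norm _ (_ / _)); last first.
  by rewrite divr_ge0// ltW.
rewrite -sqrtr_sqr ler_wsqrtr//; apply: lb_le_inf.
  by exists (\sum_i u0 i ^+ 2), u0.
move=> _ [u /= uv <-].
have S0 : 0 <= \sum_i u i ^+ 2 by apply: sumr_ge0 => i _; exact: sqr_ge0.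
rewrite -[leRHS]sqr_sqrtr// ler_sqr ?nnegrE ?sqrtr_ge0//; last first.
  by rewrite divr_ge0// ltW.
rewrite ler_pdivrMr// -uv fct_sumE.
apply: (le_trans (ler_norm_sum _ _ _)).
apply: (@le_trans _ _ (\sum_(i < N) Num.sqrt (\sum_i u i ^+ 2) * B)).
  apply: ler_sum => i _; rewrite [X in `|X|](_ : _ = u i * X i q f)//.
  rewrite normrM ler_pM// -sqrtr_sqr ler_wsqrtr// (bigD1 i)//= lerDl.
  by apply: sumr_ge0 => k _; exact: sqr_ge0.
rewrite sumr_const card_ord -(mulr_natr (_ * B)) -mulrA ler_wpM2l ?sqrtr_ge0//.
by rewrite ler_wpM2l ?ler_nat// ltW.
Qed.

Lemma curve_cvg (T t : R) (gamma : R -> M) (U : set M) :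
    {within `[0, T], continuous gamma} -> 0 <= t <= T -> nbhs (gamma t) U ->
  exists2 d, 0 < d & forall r, 0 <= r <= T -> `|t - r| < d -> U (gamma r).
Proof.
move=> /subspace_continuousP cg tT Ut.
have tT' : `[0, T]%classic t by rewrite /= in_itv.
have : nbhs t [set r | `[0, T]%classic r -> U (gamma r)] := cg t tT' U Ut.
move=> /nbhs_ballP[d /= d0 dU]; exists d => // r rT rd.
by apply: dU => //=; rewrite in_itv.
Qed.

(** The coordinate is absolutely continuous along the curve, and [sr_norm_ge] bounds its derivative
    almost everywhere. Staying in the chart up to [tau] is enough, the length of the whole curve
    being larger. *)
Lemma horizontal_chart_increment (T tau B : R) (gamma : R -> M)
    (c : chart R n M) (j : 'I_n) : 0 < B -> 0 <= tau <= T ->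
    horizontal X T gamma -> is_chart c ->
    (forall t, 0 <= t <= tau -> dom c (gamma t)) ->
    (forall t i, 0 <= t <= tau -> `|X i (gamma t) (fun q => c q 0 j)| <= B) ->
  (`|c (gamma tau) 0 j - c (gamma 0%R) 0 j|%:E <=
    (B * N.+1%:R)%:E * sr_length X T gamma)%E.
Proof.
move=> B0 /andP[t0 tT] [[cg ag] [u [mu_ aeu]]] cc gc gB.
have C0 : 0 < B * N.+1%:R by rewrite mulr_gt0// ltr0n.
pose f q := c q 0 j.
(* Written through the controls, the absolute derivative of the coordinate is measurable in time. *)
pose g t := `|\sum_i u i t * X i (gamma t) f|.
have g0 t : 0 <= g t by exact: normr_ge0.
have Ci0 : 0 <= (B * N.+1%:R)^-1 by rewrite invr_ge0 ltW.
have stT : `[0, tau] `<=` `[0, T] by apply: subset_itvl; rewrite bnd_simp.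
have mg : measurable_fun `[0, tau] g.
  apply: measurableT_comp => //; apply: measurable_sum => i.
  apply: measurable_funM; first exact: measurable_funS (mu_ i).1.
  apply: subspace_continuous_measurable_fun => //.
  apply/subspace_continuousP => t /[dup] ttau.
  rewrite /= in_itv/= => /andP[t0' t1].
  have cgt : gamma x @[x --> within `[0, tau] (nbhs t)] --> gamma t.
    by move/subspace_continuousP : (continuous_subspaceW stT cg); exact.
  apply: (cvg_comp gamma (fun q => X i q f) cgt); apply: smooth_at_continuous.
  have [_] := X_smooth i (gamma t); apply; apply: smooth_at_coord => //.
  by apply: gc; rewrite t0'.
have [Z [mZ Z0 ZP]] := aeu.
have good (t : R) : 0 <= t <= tau -> ~ Z t ->
    differentiable_curve_at gamma t /\
    velocity gamma t = \sum_i u i t *: X i (gamma t).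
  move=> /andP[t0' t1] nZ; apply: contrapT => h; apply: nZ; apply: ZP => /= h'.
  by apply: h; apply: h'; rewrite in_itv/= t0' (le_trans t1).
have good_f (t : R) : 0 <= t <= tau -> ~ Z t ->
    [/\ derivable (f \o gamma) t 1, velocity gamma t f = derive1 (f \o gamma) t &
     `|velocity gamma t f| = g t].
  move=> tt nZ; have [dg vg] := good t tt nZ.
  have sf : smooth_at f (gamma t) by apply: smooth_at_coord => //; exact: gc.
  split; first exact: dg.
    by rewrite /velocity asboolT.
  by rewrite vg fct_sumE.
have le1 : (`|f (gamma tau) - f (gamma 0)|%:E <=
    \int[mu]_(t in `[0%R, tau]) (g t)%:E)%E.
  apply: (@ac_increment_le _ 0 tau (f \o gamma)) => //.
    apply: ag => // _ [t /= + <-].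
    by rewrite in_itv/=; exact: gc.
  exists Z; split=> // t /= h; apply: contrapT => nZ; apply: h => tt.
  move: tt; rewrite in_itv/= => tt; have [df vf <-] := good_f t tt nZ.
  by rewrite vf; split.
apply: le_trans le1 _.
have mtau : measurable (`[0, tau] : set R) by [].
rewrite (@ge0_negligible_integral _ _ _ _ _ Z)//; last 2 first.
  exact/measurable_EFinP.
  by move=> t _; rewrite lee_fin.
(* The constant is moved to the measurable side, so that the integrand of the length enters only
   through the monotonicity of lower integrals. *)
have -> : (\int[mu]_(t in `[0%R, tau] `\` Z) (g t)%:E =
    (B * N.+1%:R)%:E *
    \int[mu]_(t in `[0%R, tau] `\` Z) ((B * N.+1%:R)^-1 * g t)%:E)%E.
  rewrite -ge0_integralZl//; last 4 first.
  - exact: measurableD.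
  - apply/measurable_EFinP; apply: measurable_funM => //.
    by apply: measurable_funS mg.
  - by move=> t _; rewrite lee_fin mulr_ge0.
  - by rewrite lee_fin ltW.
  by apply: eq_integral => t _; rewrite -EFinM mulVKf// gt_eqF.
apply: lee_wpmul2l; first by rewrite lee_fin ltW.
apply: ge0_le_lower_integral.
- by move=> t [/stT].
- by move=> t _; rewrite lee_fin mulr_ge0.
- by move=> t _; rewrite lee_fin sqrtr_ge0.
- move=> t [/=]; rewrite in_itv/= => tt nZ; rewrite lee_fin.
  have [_ _ <-] := good_f t tt nZ; rewrite ler_pdivrMl//.
  apply: sr_norm_ge => //; last by move=> i; exact: gB.
  by have [_ ->] := good t tt nZ; exists (u^~ t).
Qed.

End horizontal_curves.

(** * Chart balls and the escape of short horizontal curves *)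

Section chart_balls.
Context {R : realType} {n : nat} {M : manifold R n}.
Implicit Types (q s : M) (c : chart R n M) (r : R).

Definition chart_ball c s r : set M := dom c `&` [set q | `|c s - c q| <= r].

(** When the coordinate ball lies in [cod c], the chart ball is its image under the continuous
    inverse chart. *)
Lemma chart_ball_compact c s r : 0 < r ->
  (forall y, `|c s - y| <= r -> cod c y) -> compact (chart_ball c s r).
Proof.
move=> r0 rc.
have -> : chart_ball c s r = cinv c @` [set y | `|c s - y| <= r].
  apply/seteqP; split => [q [dq qr]|_ [y /= yr <-]].
    by exists (c q) => //; rewrite cmapK.
  by have [dy cy] := cinvK (rc _ yr); split=> //=; rewrite cy.
apply: continuous_compact; last exact: compact_ball_rV.
apply: continuous_in_subspaceT => y; rewrite inE/= => yr.
by apply: cinv_continuous; exact: rc.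
Qed.

Lemma chart_ball_closed c s r : 0 < r ->
  (forall y, `|c s - y| <= r -> cod c y) -> closed (chart_ball c s r).
Proof.
move=> r0 rc; apply: compact_closed; first exact: manifold_hausdorff.
exact: chart_ball_compact.
Qed.

Lemma chart_dist_continuous c s q :
  dom c q -> {for q, continuous (fun q => `|c s - c q|)}.
Proof.
move=> dq; apply: (@continuous_comp _ _ _ (fun q => c s - c q)).
  by apply: cvgB; [exact: cvg_cst|exact: cmap_continuous].
exact: norm_continuous.
Qed.

Lemma chart_ball_nbhs c s r q : dom c q -> `|c s - c q| < r ->
  \forall x \near q, dom c x /\ `|c s - c x| < r.
Proof.
move=> dq qr; apply: filterI.
  by apply: open_nbhs_nbhs; split => //; exact: dom_open.
exact: (cvgr_lt _ (chart_dist_continuous (s := s) dq)).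
Qed.

Lemma chart_radius c s : dom c s ->
  exists2 r, 0 < r & forall y, `|c s - y| <= r -> cod c y.
Proof.
move=> ds; have /nbhs_ballP[e /= e0 eU] : nbhs (c s) (cod c).
  by apply: open_nbhs_nbhs; split; [exact: cod_open|exists s].
exists (e / 2); first by rewrite divr_gt0.
move=> y ye; apply: eU; rewrite -ball_normE/=.
by apply: (le_lt_trans ye); rewrite ltr_pdivrMr// ltr_pMr// ltr1n.
Qed.

Context {N : nat}.
Variable X : 'I_N -> vector_field M.
Hypothesis X_smooth : forall i, smooth_vector_field (X i).

Lemma chart_ball_coord_bound c s r : is_chart c -> 0 < r ->
    (forall y, `|c s - y| <= r -> cod c y) ->
  exists2 B, 0 < B & forall q i j, chart_ball c s r q ->
    `|X i q (fun q => c q 0 j)| <= B.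
Proof.
move=> cc r0 rc.
have bnd (ij : 'I_N * 'I_n) : exists B, forall q, chart_ball c s r q ->
    `|X ij.1 q (fun q => c q 0 ij.2)| <= B.
  case: ij => i j /=.
  have cX : {within chart_ball c s r,
      continuous (fun q => X i q (fun q => c q 0 j))}.
    apply: continuous_in_subspaceT => q; rewrite inE => -[dq _].
    apply: smooth_at_continuous; have [_] := X_smooth i q; apply.
    exact: smooth_at_coord.
  have /compact_bounded[B [_ BP]] :=
    continuous_compact cX (chart_ball_compact r0 rc).
  by exists (B + 1) => q Kq; apply: (BP (B + 1)); [rewrite ltrDl|exists q].
have [B BP] := choice bnd.
(* The sum dominates every bound of the finite family, and the [1] makes it positive even if the
   family is empty. *)
exists (1 + \sum_ij `|B ij|).
  by rewrite ltr_pwDl// sumr_ge0.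
move=> q i j Kq; apply: le_trans (BP (i, j) _ Kq) _.
apply: le_trans (ler_norm _) _.
rewrite (bigD1 (i, j))//= addrCA lerDl addr_ge0// sumr_ge0//.
Qed.

(** Up to its first exit from the open ball of radius [r], a curve issued from the half ball changes
    some coordinate by at least [r / 2], which costs a length of at least [eta]. *)
Lemma chart_ball_escape c s r : is_chart c -> dom c s -> 0 < r ->
    (forall y, `|c s - y| <= r -> cod c y) ->
  exists2 eta, 0 < eta & forall q0 q, chart_ball c s (r / 2) q0 ->
    (sr_dist X q0 q < eta%:E)%E -> chart_ball c s r q.
Proof.
move=> cc ds r0 rc.
have r2 : 0 < r / 2 by rewrite divr_gt0.
have [B B0 BP] := chart_ball_coord_bound cc r0 rc.
have C0 : 0 < B * N.+1%:R by rewrite mulr_gt0// ltr0n.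
exists ((r / 2) / (B * N.+1%:R)); first by rewrite divr_gt0.
move=> q0 q [dq0 q0r] /ereal_inf_lt[_ [T [gamma [T0 hg g0 gT ->]]] lT].
have cg := hg.1.1.
pose O := dom c `&` [set q | `|c s - c q| < r].
suff [dq /ltW qr] : O q by split.
have nO x : O x -> nbhs x O by move=> [dx xr]; exact: chart_ball_nbhs.
apply: contrapT => nOq.
pose A := [set t | 0 <= t <= T /\ ~ O (gamma t)].
have AT : A T by split; [rewrite T0 lexx|rewrite gT].
have lbA : lbound A 0 by move=> t [/andP[]].
have hiA : has_inf A by split; [exists T|exists 0].
pose tau := inf A.
have t0 : 0 <= tau by apply: lb_le_inf => //; exists T.
have tT : tau <= T by apply: ge_inf => //; exists 0.
have ltO t : 0 <= t -> t < tau -> O (gamma t).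
  move=> t0' tt; apply: contrapT => nOt.
  have : tau <= t.
    apply: ge_inf; first by exists 0.
    by split => //; rewrite t0' ltW// (lt_le_trans tt).
  by rewrite leNgt tt.
(* Lying outside the open ball is a closed condition, so it persists at the infimum of the exit
   times. *)
have nOt : ~ O (gamma tau).
  move=> /nO Ot; have [|d d0 dO] := curve_cvg cg _ Ot; first by rewrite t0.
  have [t At] := inf_adherent d0 hiA; rewrite -/tau => td.
  have taut : tau <= t by apply: ge_inf At; exists 0.
  apply: At.2; apply: dO; first by case: At.
  by rewrite distrC ger0_norm ?subr_ge0// ltrBlDl.
have tau0 : 0 < tau.
  rewrite lt_neqAle t0 andbT; apply/eqP => tE; apply: nOt; rewrite -tE g0.
  split=> //=; apply: (le_lt_trans q0r).
  by rewrite ltr_pdivrMr// ltr_pMr// ltr1n.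
(* As a limit of earlier points, the exit point stays in the closed chart ball, hence in the domain
   of the chart; the total function [c] alone would not show this. *)
have Ktau : chart_ball c s r (gamma tau).
  apply: contrapT => nK.
  have oK : nbhs (gamma tau) (~` chart_ball c s r).
    apply: open_nbhs_nbhs; split => //; apply: closed_openC.
    exact: chart_ball_closed.
  have [|d d0 dK] := curve_cvg cg _ oK; first by rewrite t0.
  pose t := Num.max 0 (tau - d / 2).
  have t1 : 0 <= t by rewrite le_max lexx.
  have d2 : 0 < d / 2 by rewrite divr_gt0.
  have t2 : t < tau by rewrite gt_max tau0; lra.
  have t3 : tau - d / 2 <= t by rewrite le_max lexx orbT.
  have [||dt /ltW tr] := ltO t => //.
  apply: (dK t) => //; first by rewrite t1 (le_trans (ltW t2)).
  by rewrite gtr0_norm ?subr_gt0//; lra.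
have Kt t : 0 <= t <= tau -> chart_ball c s r (gamma t).
  move=> /andP[t0']; rewrite le_eqVlt => /predU1P[->//|tt].
  by have [dt /ltW] := ltO t t0' tt.
have rt : r <= `|c s - c (gamma tau)|.
  by rewrite leNgt; apply/negP => h; apply: nOt; split => //; exact: Ktau.1.
have dr : r / 2 <= `|c (gamma tau) - c (gamma 0)|.
  have := ler_distD (c (gamma 0)) (c s) (c (gamma tau)).
  move: q0r; rewrite g0 (distrC (c q0) (c (gamma tau))) /=; lra.
have [j] := norm_coord_ge r2 dr; rewrite !mxE => rj.
have inc : (`|c (gamma tau) 0 j - c (gamma 0%R) 0 j|%:E <=
    (B * N.+1%:R)%:E * sr_length X T gamma)%E.
  apply: horizontal_chart_increment => //; first by rewrite t0.
    by move=> t /Kt[].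
  by move=> t i /Kt; exact: BP.
have : ((B * N.+1%:R)%:E * sr_length X T gamma < (r / 2)%:E)%E.
  by rewrite muleC -lte_pdivlMr.
by apply/negP; rewrite -leNgt (le_trans _ inc).
Qed.

End chart_balls.

(** * Gluing over a compact set and cutoff functions *)

Lemma compact_union_ind (T : topologicalType) (P : set (set T)) (S : set T) :
    P set0 -> (forall A B, P A -> P B -> P (A `|` B)) ->
    (forall A B, B `<=` A -> P A -> P B) ->
    (forall s, S s -> exists2 A, P A & nbhs s A) ->
  compact S -> P S.
Proof.
move=> P0 PU PS Ploc /compact_near_coveringP cS.
(* [F] collects the properties shared by all large enough members of [P], which are directed by
   union. The near-covering form of compactness then replaces the extraction of a finite
   subcover. *)
pose F : set_system (set T) :=
  [set Q | exists2 A, P A & forall B, P B -> A `<=` B -> Q B].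
have FF : Filter F.
  split.
  - by exists set0.
  - move=> Q Q' [A PA AQ] [A' PA' AQ']; exists (A `|` A'); first exact: PU.
    move=> B PB AB; split; [apply: AQ => //|apply: AQ' => //].
      by move=> x Ax; apply: AB; left.
    by move=> x Ax; apply: AB; right.
  - by move=> Q Q' QQ' [A PA AQ]; exists A => // B PB AB; exact/QQ'/AQ.
have [|A PA AS] := cS _ F (fun A s => A s) FF.
  move=> s Ss; have [A PA sA] := Ploc s Ss.
  exists (A, [set B | A `<=` B]) => /=; last by move=> [x B] /= [Ax]; apply.
  by split => //=; exists A.
by apply: (PS A) => //; exact: AS.
Qed.

Lemma compactU (T : topologicalType) (A B : set T) :
  compact A -> compact B -> compact (A `|` B).
Proof.
move=> cA cB.
have := @bigsetU_compact T bool (fun b => if b then A else B)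
  [:: true; false] xpredT.
by rewrite !big_cons big_nil setU0; apply; case.
Qed.

Section cutoff.
Context {R : realType} {n : nat} {M : manifold R n}.
Implicit Types (q s : M) (c : chart R n M) (r : R).

Lemma chart_bump c s r : 0 < r -> (forall y, `|c s - y| <= r -> cod c y) ->
  exists f : M -> R, [/\ continuous f,
    forall q, chart_ball c s (r / 2) q -> f q = 1,
    forall q, ~ chart_ball c s r q -> f q = 0 &
    forall q, 0 <= f q <= 1].
Proof.
move=> r0 rc.
(* This profile is 1 up to distance [r / 2] and decreases linearly to 0 at distance [r]. *)
pose g q : R := Num.max 0 (Num.min 1 (2 - (2 / r) * `|c s - c q|)).
pose f q : R := if `[< dom c q >] then g q else 0.
have r2 : 0 < 2 / r by rewrite divr_gt0.
have f0 q : ~ chart_ball c s r q -> f q = 0.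
  rewrite /f; case: asboolP => // dq nB.
  have rq : r < `|c s - c q| by rewrite ltNge; apply/negP => h; exact: nB.
  apply/max_idPl; rewrite ge_min; apply/orP; right.
  by rewrite subr_le0 mulrAC ler_pdivlMr// ler_pM2l// ltW.
exists f; split => //.
- move=> q; have [dq|ndq] := pselect (dom c q).
    apply: (@near_eq_continuous _ _ g).
      apply: (@filterS _ _ _ (dom c)); first by move=> x dx; rewrite /f asboolT.
      by apply: open_nbhs_nbhs; split => //; exact: dom_open.
    have h : {for q, continuous (fun q => 2 - (2 / r) * `|c s - c q|)}.
      apply: cvgB; first exact: cvg_cst.
      by apply: cvgM; [exact: cvg_cst|exact: chart_dist_continuous].
    apply: (@continuous_max _ _ (fun=> 0)); first exact: cst_continuous.
    by apply: (@continuous_min _ _ (fun=> 1)); first exact: cst_continuous.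
  (* Outside the domain of the chart, [f] vanishes near [q], because the compact chart ball is
     closed in [M]. *)
  apply: (@near_eq_continuous _ _ (fun=> 0)); last exact: cst_continuous.
  apply: (@filterS _ _ _ (~` chart_ball c s r)); first by move=> x /f0.
  apply: open_nbhs_nbhs; split; last by case.
  by apply: closed_openC; exact: chart_ball_closed.
- move=> q [dq /= qr]; rewrite /f asboolT//.
  rewrite /g min_l ?max_r//.
  suff : 2 / r * `|c s - c q| <= 1 by lra.
  by rewrite mulrAC ler_pdivrMr// mul1r; lra.
- move=> q; rewrite /f; case: ifP => _; last by rewrite lexx ler01.
  by rewrite le_max lexx/= ge_max ler01/= ge_min lexx.
Qed.

Context {N : nat}.
Variable X : 'I_N -> vector_field M.
Hypothesis X_smooth : forall i, smooth_vector_field (X i).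

Lemma compact_tube_cutoff (S : set M) : compact S ->
  exists eta (K : set M) (chi : M -> R), [/\ 0 < eta, compact K /\ S `<=` K,
    tube X S eta `<=` K, continuous chi /\ compact_support chi &
    forall q, K q -> chi q = 1].
Proof.
move=> cS.
(* The property is shaped to survive unions: [L] keeps the support compact, and values in [[0, 1]]
   make the maximum of two cutoffs equal to 1 on both sets [K]. *)
pose P (A : set M) := exists eta (K L : set M) (chi : M -> R),
  [/\ 0 < eta, compact K /\ compact L,
    A `<=` K /\ (forall s q, A s -> (sr_dist X s q < eta%:E)%E -> K q),
    continuous chi & [/\ forall q, K q -> chi q = 1,
    forall q, ~ L q -> chi q = 0 & forall q, 0 <= chi q <= 1]].
have [eta [K [L [chi [eta0 [cK cL] [SK KP] cchi [chi1 chi0 _]]]]]] : P S.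
  apply: compact_union_ind cS.
  - exists 1, set0, set0, (fun=> 0); split => //.
    + by split; exact: compact0.
    + by split => // q s [].
    + by move=> q; exact: cst_continuous.
    + by split => // q; rewrite lexx ler01.
  - move=> A B [e [K [L [f [e0 [cK cL] [AK KP] cf [f1 f0 f01]]]]]].
    move=> [e' [K' [L' [f' [e0' [cK' cL'] [AK' KP'] cf' [f1' f0' f01']]]]]].
    exists (Num.min e e'), (K `|` K'), (L `|` L'), (f \max f'); split => //.
    + by rewrite lt_min e0.
    + by split; exact: compactU.
    + split; first exact: setUSS.
      move=> s q [As|Bs]; rewrite EFin_min lt_min => /andP[h h'].
        by left; exact: KP h.
      by right; exact: KP' h'.
    + by move=> q; apply: continuous_max; [exact: cf|exact: cf'].
    + split.
      * move=> q [/f1|/f1'] /= ->.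
          by apply/max_idPl; case/andP: (f01' q).
        by apply/max_idPr; case/andP: (f01 q).
      * move=> q /= nq; rewrite f0 ?f0' ?maxxx// => h; apply: nq; [by right|by left].
      * move=> q /=; have /andP[a b] := f01 q; have /andP[a' b'] := f01' q.
        by rewrite le_max a/= ge_max b.
  - move=> A B BA [e [K [L [f [e0 cKL [AK KP] cf fP]]]]].
    exists e, K, L, f; split => //; split; first exact: subset_trans AK.
    by move=> s q /BA; exact: KP.
  - move=> s _; have [c /atlas_is_chart cc ds] := atlas_cover s.
    have [r r0 rc] := chart_radius ds.
    have r2 : 0 < r / 2 by rewrite divr_gt0.
    have r4 : 0 < r / 2 / 2 by rewrite divr_gt0.
    have rc2 y : `|c s - y| <= r / 2 -> cod c y by move=> h; apply: rc; lra.
    have [f [cf f1 f0 f01]] := chart_bump r0 rc.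
    (* Three nested balls are used: short curves from radius [r / 4] stay within [r / 2], where the
       bump is 1, and the bump vanishes outside radius [r]. *)
    have [e e0 eP] := chart_ball_escape X_smooth cc ds r2 rc2.
    exists (chart_ball c s (r / 2 / 2)).
      exists e, (chart_ball c s (r / 2)), (chart_ball c s r), f; split => //.
      + by split; exact: chart_ball_compact.
      + by split => // q [dq /= qr]; split => //=; lra.
    have : `|c s - c s| < r / 2 / 2 by rewrite subrr normr0.
    move=> /(chart_ball_nbhs ds); apply: filterS => q [dq /ltW qr]; by split.
exists eta, K, chi; split => //.
- by move=> q [_ /ereal_inf_lt[_ [s Ss <-]]]; exact: KP.
- split=> //; apply: (subclosed_compact _ cL); first exact: closed_closure.
  have -> : L = closure L.
    by apply/closure_id; exact: (compact_closed (@manifold_hausdorff _ _ M) cL).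
  apply: closure_subset => q /eqP chiq; apply: contrapT => /chi0.
  exact: chiq.
Qed.

End cutoff.

(** * Measures concentrated on a compact set *)

Section borel_topology.
Context {R : realType} {T : ptopologicalType}.
Local Notation B := (g_sigma_algebraType (@open T)).

Lemma borel_open_measurable (A : set T) : open A -> measurable (A : set B).
Proof. exact: sub_sigma_algebra. Qed.

Lemma borel_closed_measurable (A : set T) : closed A -> measurable (A : set B).
Proof.
move=> cA; rewrite -(setCK A); apply: measurableC.
by apply: borel_open_measurable; exact: closed_openC.
Qed.

Lemma borel_continuous_measurable (f : T -> R) (D : set B) :
  measurable D -> continuous f -> measurable_fun D (f : B -> R).
Proof.
move=> mD /continuousP cf.
apply: (measurability _ (RGenOpens.measurableE R)).
move=> _ [_ [a [b ->] <-]]; apply: measurableI => //.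
by apply: borel_open_measurable; apply: cf; exact: interval_open.
Qed.

Section concentrated.
Variables (K : set T) (nu : {measure set B -> \bar R}).
Hypotheses (cK : compact K) (clK : closed K).
Hypotheses (nu1 : (nu setT <= 1)%E) (nuK : nu (~` K) = 0%E).
Implicit Types f g : T -> R.

Let mK : measurable (K : set B) := borel_closed_measurable clK.

Let nuK1 : (nu K <= 1)%E.
Proof. by apply: le_trans nu1; apply: le_measure; rewrite ?inE. Qed.

Lemma ge0_concentrated_integral (f : B -> \bar R) :
    measurable_fun setT f -> (forall x, 0 <= f x)%E ->
  (\int[nu]_x f x = \int[nu]_(x in K) f x)%E.
Proof.
move=> mf f0; rewrite (@ge0_negligible_integral _ B R nu setT (~` K))//.
  by rewrite setTD setCK.
exact: measurableC.
Qed.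

(** A continuous function is bounded on the compact [K], and its values elsewhere sit on a null
    set. *)
Lemma concentrated_integrable f : continuous f ->
  nu.-integrable setT (EFin \o (f : B -> R)).
Proof.
move=> cf; have mf : measurable_fun setT (f : B -> R).
  exact: borel_continuous_measurable.
have : nu.-integrable K (EFin \o (f : B -> R)).
  apply: measurable_bounded_integrable => //.
  - by rewrite (le_lt_trans nuK1)// ltry.
  - exact: measurable_funS mf.
  - have /compact_bounded[m [mr mP]] :=
      continuous_compact (continuous_subspaceT cf) cK.
    by exists m; split=> // x mx y Ky; apply: (mP x) => //; exists y.
move=> /integrableP[_ fK]; apply/integrableP.
split; first exact/measurable_EFinP.
rewrite ge0_concentrated_integral//.
by apply: measurableT_comp => //; exact/measurable_EFinP.
Qed.

Lemma concentrated_integralE f : continuous f ->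
  (\int[nu]_x ((f : B -> R) x)%:E)%E = (\int[nu]_x (f : B -> R) x)%:E.
Proof.
move=> cf; rewrite /Rintegral fineK//; apply: integrable_fin_num => //.
exact: concentrated_integrable.
Qed.

Lemma concentrated_Rintegral_dist f g (e : R) : continuous f -> continuous g ->
    0 <= e -> (forall x, K x -> `|f x - g x| <= e) ->
  `|\int[nu]_x (f : B -> R) x - \int[nu]_x (g : B -> R) x| <= e.
Proof.
move=> cf cg e0 fg.
have cfg : continuous (fun x => f x - g x).
  by move=> x; apply: cvgB; [exact: cf|exact: cg].
have ifg := concentrated_integrable cfg.
rewrite -RintegralB//; [|exact: concentrated_integrable..].
apply: (le_trans (le_normr_Rintegral _ ifg)) => //.
rewrite -lee_fin /Rintegral fineK; last first.
  apply: integrable_fin_num => //; exact: integrable_norm ifg.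
have mfg : measurable_fun setT (fun x : B => (`|f x - g x|)%:E).
  apply/measurable_EFinP; apply: measurableT_comp => //.
  exact: borel_continuous_measurable.
rewrite ge0_concentrated_integral//.
apply: (@le_trans _ _ (\int[nu]_(x in K) (cst e%:E x))%E).
  by apply: ge0_le_integral => //; exact: measurable_funS mfg.
by rewrite (@integral_cst _ B R nu K mK e%:E) -[leRHS]mule1 lee_wpmul2l.
Qed.

Lemma concentrated_Rintegral_eq f g : continuous f -> continuous g ->
    (forall x, K x -> f x = g x) ->
  \int[nu]_x (f : B -> R) x = \int[nu]_x (g : B -> R) x.
Proof.
move=> cf cg fg; apply/eqP; rewrite -subr_eq0 -normr_le0.
by apply: concentrated_Rintegral_dist => // x Kx; rewrite fg// subrr normr0.
Qed.

End concentrated.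

(** * Potentials and convergence of energies *)

Section energy.
Variable p : T -> T -> R.
Hypothesis p_continuous : continuous (fun z : T * T => p z.1 z.2).
Variables (K : set T).
Hypotheses (cK : compact K) (clK : closed K).

Lemma section_continuous y : continuous (p^~ y).
Proof.
move=> x; apply: (@continuous_comp _ _ _ (fun x => (x, y)) (fun z => p z.1 z.2)).
  by apply: cvg_pair; [exact: cvg_id|exact: cvg_cst].
exact: @p_continuous (x, y).
Qed.

(** Joint continuity gives a product neighbourhood of each [(x, y0)]; compactness of [K] makes its
    second factor uniform in [x]. *)
Lemma kernel_equicontinuous y0 (e : R) : 0 < e ->
  \forall y \near y0, forall x, K x -> `|p x y - p x y0| < e.
Proof.
move=> e0; have e2 : 0 < e / 2 by rewrite divr_gt0.
move/compact_near_coveringP : cK.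
move=> /(_ _ (nbhs y0) (fun y x => `|p x y - p x y0| < e)); apply.
move=> x Kx.
have cxy : p z.1 z.2 @[z --> (x, y0)] --> p x y0 := @p_continuous (x, y0).
move/cvgrPdist_lt : cxy => /(_ _ e2)[[U V] /= [Ux Vy0] UV].
exists (U, V) => // -[x' y] /= [Ux' Vy].
have h1 := UV (x', y) (conj Ux' Vy).
have h2 := UV (x', y0) (conj Ux' (nbhs_singleton Vy0)).
move: h1 h2 => /= h1 h2.
rewrite -(subrKA (p x y0)) (le_lt_trans (ler_normD _ _))//.
by rewrite (splitr e) ltrD// distrC.
Qed.

Definition potential (nu : {measure set B -> \bar R}) (y : T) : R :=
  \int[nu]_x p x y.

Lemma potential_equicontinuous y0 (e : R) : 0 < e ->
  \forall y \near y0, forall nu : {measure set B -> \bar R},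
    (nu setT <= 1)%E -> nu (~` K) = 0%E ->
    `|potential nu y - potential nu y0| <= e.
Proof.
move=> e0; apply: filterS (kernel_equicontinuous y0 e0) => y py nu nu1 nuK.
apply: (concentrated_Rintegral_dist cK clK nu1 nuK); last 1 first.
- by move=> x Kx; rewrite ltW// py.
- exact: section_continuous.
- exact: section_continuous.
- exact: ltW.
Qed.

Lemma potential_continuous (nu : {measure set B -> \bar R}) :
  (nu setT <= 1)%E -> nu (~` K) = 0%E -> continuous (potential nu).
Proof.
move=> nu1 nuK y0; apply/cvgrPdist_le => e e0.
by apply: filterS (potential_equicontinuous y0 e0) => y; rewrite distrC; exact.
Qed.

Lemma energy_cvg (I : Type) (F : set_system I) {FF : Filter F}
    (nu : I -> {measure set B -> \bar R}) (mu : {measure set B -> \bar R}) :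
    (\forall i \near F, (nu i setT <= 1)%E /\ nu i (~` K) = 0%E) ->
    (mu setT <= 1)%E -> mu (~` K) = 0%E ->
    (forall f : T -> R, continuous f ->
      \int[nu i]_x (f : B -> R) x @[i --> F] --> \int[mu]_x (f : B -> R) x) ->
  \int[nu i]_y (potential (nu i) : B -> R) y @[i --> F] -->
  \int[mu]_y (potential mu : B -> R) y.
Proof.
move=> nuP mu1 muK nu_mu.
have cmu := potential_continuous mu1 muK.
apply/cvgrPdist_le => e e0.
have e2 : 0 < e / 2 by rewrite divr_gt0.
have e3 : 0 < e / 2 / 3 by rewrite divr_gt0.
(* One third of [e / 2] goes to the passage between [y] and [y0] for [nu i], one to that for [mu],
   and one to the convergence at [y0]. *)
have unif : \forall i \near F, K `<=`
    (fun y => `|potential (nu i) y - potential mu y| <= e / 2).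
  move/compact_near_coveringP : cK; apply => // y0 _.
  have /cvgrPdist_le/(_ _ e3) ny0 := nu_mu _ (section_continuous (y := y0)).
  near=> y i.
  have [nu1 nuK] : (nu i setT <= 1)%E /\ nu i (~` K) = 0%E.
    by near: i; exact: nuP.
  have ey : forall nu : {measure set B -> \bar R},
      (nu setT <= 1)%E -> nu (~` K) = 0%E ->
      `|potential nu y - potential nu y0| <= e / 2 / 3.
    by near: y; exact: potential_equicontinuous.
  have h1 := ey _ nu1 nuK; have h2 := ey _ mu1 muK.
  have h3 : `|potential mu y0 - potential (nu i) y0| <= e / 2 / 3.
    by near: i; exact: ny0.
  move: h1 h2 h3; rewrite !ler_norml => /andP[? ?] /andP[? ?] /andP[? ?].
  by apply/andP; split; lra.
near=> i.
have [nu1 nuK] : (nu i setT <= 1)%E /\ nu i (~` K) = 0%E.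
  by near: i.
(* The measure changes first, against the fixed continuous potential of [mu]; then the potential
   changes, under [nu i] of mass at most 1. *)
rewrite -(subrKA (\int[nu i]_y (potential mu : B -> R) y)).
rewrite (le_trans (ler_normD _ _))//.
rewrite (splitr e) lerD//.
  by near: i; have /cvgrPdist_le := nu_mu _ cmu; exact.
rewrite distrC; apply: (concentrated_Rintegral_dist cK clK nu1 nuK).
- exact: potential_continuous.
- exact: cmu.
- exact: ltW.
- by near: i.
Unshelve. all: by end_near. Qed.

End energy.
End borel_topology.

(** * Tubes and the heat kernel *)

Section conditional_measure.
Context d {T : measurableType d} {R : realType}.
Variable omega : {measure set T -> \bar R}.

Let inv_ge0 (A : set T) : 0 <= (fine (omega A))^-1.
Proof. by rewrite invr_ge0 fine_ge0. Qed.

(* This is the zero measure when [omega A] is [0] or [+oo], because then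
   [(fine (omega A))^-1 = 0]. *)
Definition conditional_measure (A : set T) : {measure set T -> \bar R} :=
  match pselect (measurable A) with
  | left mA => mscale (NngNum (inv_ge0 A)) (mrestr omega mA)
  | right _ => mzero
  end.

Lemma conditional_measureE (A B : set T) : measurable A ->
  conditional_measure A B = (((fine (omega A))^-1)%:E * omega (B `&` A))%E.
Proof. by move=> mA; rewrite /conditional_measure; case: pselect. Qed.

Lemma conditional_measure_le1 (A : set T) :
  measurable A -> (conditional_measure A setT <= 1)%E.
Proof.
move=> mA; rewrite conditional_measureE// setTI.
have [->|Aoo] := eqVneq (omega A) +oo%E; first by rewrite /= invr0 mul0e.
have Afin : omega A \is a fin_num by rewrite ge0_fin_numE// ltey.
rewrite -[X in (_ * X)%E](fineK Afin) -EFinM lee_fin.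
have [->|A0] := eqVneq (fine (omega A)) 0; first by rewrite mulr0.
by rewrite mulVf.
Qed.

Lemma conditional_measure_setC (A K : set T) : measurable A -> A `<=` K ->
  conditional_measure A (~` K) = 0%E.
Proof.
move=> mA AK; rewrite conditional_measureE//.
have -> : ~` K `&` A = set0 by apply/disjoints_subset; exact: subsetC.
by rewrite measure0 mule0.
Qed.

End conditional_measure.

Lemma continuous_mx (R : realType) (T : topologicalType) m n
    (f : T -> 'M[R]_(m, n)) (x : T) :
  (forall i j, {for x, continuous (fun y => f y i j)}) ->
  {for x, continuous f}.
Proof.
move=> cf P /= [A Afx AP].
apply: (@filterS _ (nbhs x) _ (fun y => forall i j, A i j (f y i j))).
  by move=> y fy; exact: AP.
apply: filter_forall => i; apply: filter_forall => j.
exact: cf (Afx i j).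
Qed.

Section tubes.
Context {R : realType} {n N : nat} {M : manifold R n}.
Variable X : 'I_N -> vector_field M.

(* Continuity of [fine \o dist_from X S] suffices, as [fine] vanishes where
   the distance is infinite. *)
Lemma tube_open (S : set M) (r0 e : R) :
  tubular_radius X S r0 -> e <= r0 -> open (tube X S e).
Proof.
move=> [r00 rP _ _] er; rewrite openE => q [q0 qe].
have qr : tube X S r0 q by split=> //; rewrite (lt_le_trans qe)// lee_fin.
have [/smooth_at_continuous cq _] := rP q qr.
have dE x : 0 < fine (dist_from X S x) ->
    dist_from X S x = (fine (dist_from X S x))%:E.
  by case: (dist_from X S x) => //=; rewrite ltxx.
have fq : 0 < fine (dist_from X S q) < e.
  move: q0 qe; case: (dist_from X S q) => //= r.
  by rewrite !lte_fin => -> ->.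
have /andP[fq0 fqe] := fq.
have h1 : \forall x \near q, 0 < fine (dist_from X S x) by exact: (cvgr_gt _ cq).
have h2 : \forall x \near q, fine (dist_from X S x) < e by exact: (cvgr_lt _ cq).
apply: filterS2 h1 h2 => x x0 xe.
by split; rewrite dE// lte_fin.
Qed.

End tubes.

(** Order 0 of smoothness is continuity in charts; near a point, the kernel at time [t] is its chart
    expression [P] composed with the coordinate map [Phi], in which time is frozen. *)
Lemma smooth_kernel_continuous (R : realType) (n : nat) (M : manifold R n)
    (p : R -> M -> M -> R) (t : R) :
  smooth_kernel p -> 0 < t -> continuous (fun z : M * M => p t z.1 z.2).
Proof.
move=> sp t0 [x y].
have [c /atlas_is_chart cc dx] := atlas_cover x.
have [c' /atlas_is_chart cc' dy] := atlas_cover y.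
pose Phi (z : M * M) : 'rV[R]_(1 + (n + n)) :=
  row_mx (t%:M : 'rV[R]_1) (row_mx (c z.1) (c' z.2)).
pose P (w : 'rV[R]_(1 + (n + n))) := p (w 0 0)
  (cinv c (lsubmx (rsubmx w))) (cinv c' (rsubmx (rsubmx w))).
have Phi00 z : Phi z 0 0 = t.
  rewrite /Phi mxE; case: splitP => [j _|j /=].
    by rewrite mxE (ord1 j).
  by [].
have PPhi z : dom c z.1 -> dom c' z.2 -> P (Phi z) = p t z.1 z.2.
  by move=> d1 d2; rewrite /P Phi00 /Phi !(row_mxKr, row_mxKl) !cmapK.
have cPhi : {for (x, y), continuous Phi}.
  apply: continuous_mx => i j; case: (split_ordP j) => [a ->|a ->].
    have -> : (fun z => Phi z i (lshift (n + n) a)) =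
        fun=> (t%:M : 'rV[R]_1) i a.
      by apply/funext => z; rewrite /Phi row_mxEl.
    exact: cst_continuous.
  case: (split_ordP a) => [b ->|b ->].
    have -> : (fun z => Phi z i (rshift 1 (lshift n b))) = fun z => c z.1 i b.
      by apply/funext => z; rewrite /Phi row_mxEr row_mxEl.
    apply: (@continuous_comp _ _ _ fst (fun q => c q i b)).
      exact: cvg_fst.
    apply: (@continuous_comp _ _ _ c (fun w => w i b)).
      exact: cmap_continuous.
    exact: coord_continuous.
  have -> : (fun z => Phi z i (rshift 1 (rshift n b))) = fun z => c' z.2 i b.
    by apply/funext => z; rewrite /Phi !row_mxEr.
  apply: (@continuous_comp _ _ _ snd (fun q => c' q i b)); first exact: cvg_snd.
  apply: (@continuous_comp _ _ _ c' (fun w => w i b)).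
    exact: cmap_continuous.
  exact: coord_continuous.
apply: (@near_eq_continuous _ _ (P \o Phi)).
  exists (dom c, dom c') => /=.
    by split; apply: open_nbhs_nbhs; split => //; exact: dom_open.
  by move=> [x' y'] /= [d1 d2]; exact: PPhi.
apply: continuous_comp; first exact: cPhi.
apply: (sp c c' cc cc' 0) => /=; split; first by rewrite Phi00.
- by rewrite /Phi row_mxKr row_mxKl; exists x.
- by rewrite /Phi !row_mxKr; exists y.
Qed.

Theorem proposition5p1 (R : realType) (n N : nat) (M : manifold R n)
    (X : 'I_N -> vector_field M)
    (omega : {measure set (borel M) -> \bar R})
    (p : R -> M -> M -> R)
    (S : set M) (k : nat) (muS : probability (borel M) R) (r0 : R)
    (M_connected : connected [set: M])
    (X_smooth : forall i, smooth_vector_field (X i))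
    (X_generating : bracket_generating X)
    (M_complete : sr_complete X)
    (omega_smooth : smooth_measure n [set: M] omega)
    (p_heat : heat_kernel X omega p)
    (codim_S : (1 <= k <= n)%N)
    (S_submanifold : embedded_submanifold (n - k) S)
    (S_compact : compact S)
    (S_nonchar : noncharacteristic X S)
    (muS_induced : induced_measure X omega (n - k) S muS)
    (r0_tubular : tubular_radius X S r0) :
  forall t : R, 0 < t ->
    H_tube X omega S p e t @[e --> 0^'+] --> H_limit S muS p t.
Proof.
move=> t t0.
have [p_pos p_smooth _] := p_heat.
have [[muSC _] muS_lim] := muS_induced.
have [eta [K [chi [eta0 [cK SK] tubeK [cchi supp_chi] chi1]]]] :=
  compact_tube_cutoff X_smooth S_compact.
have clK : closed K := compact_closed (@manifold_hausdorff _ _ M) cK.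
have clS : closed S := compact_closed (@manifold_hausdorff _ _ M) S_compact.
have cp := smooth_kernel_continuous p_smooth t0.
pose nu (e : R) := conditional_measure omega (tube X S e).
have r00 : 0 < r0 by case: r0_tubular.
have near_mtube : \forall e \near 0^'+, measurable (tube X S e : set (borel M)).
  near=> e; apply: borel_open_measurable; apply: tube_open r0_tubular _.
  by near: e; exact: nbhs_right_le.
(* [tube_measure] is a bare set function; it is identified with a bundled measure once [e] is small
   enough for the tube to be open. *)
have nuE : \forall e \near 0^'+, tube_measure X omega S e = nu e.
  apply: filterS near_mtube => e me; apply/funext => A.
  by rewrite /nu conditional_measureE.
have nuP : \forall e \near 0^'+, (nu e setT <= 1)%E /\ nu e (~` K) = 0%E.
  near=> e; have me : measurable (tube X S e : set (borel M)) by near: e.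
  split; first exact: conditional_measure_le1.
  apply: conditional_measure_setC => //; apply: subset_trans tubeK.
  move=> q [q0 qe]; split=> //; apply: lt_le_trans qe _.
  by rewrite lee_fin; near: e; exact: nbhs_right_le.
have mu1 : (muS setT <= 1)%E by rewrite probability_setT.
have muK : muS (~` K) = 0%E.
  apply: (@subset_measure0 _ _ _ muS (~` K) (~` S)) => //.
  - by apply: measurableC; exact: borel_closed_measurable.
  - by apply: measurableC; exact: borel_closed_measurable.
  - exact: subsetC.
(* The complement of [S] is null for [muS], so the integrals over [S] and over [M] agree. *)
have muSE (f : M -> R) : continuous f ->
    (\int[muS]_(x in S) ((f : borel M -> R) x)%:E)%E =
    (\int[muS]_x (f : borel M -> R) x)%:E.
  move=> cf; rewrite -(concentrated_integralE cK clK mu1 muK cf).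
  rewrite (@negligible_integral _ (borel M) R muS setT (~` S))//.
  - by rewrite setTD setCK.
  - by apply: measurableC; exact: borel_closed_measurable.
  - exact: (concentrated_integrable cK clK mu1 muK cf).
have cvg_f (f : M -> R) : continuous f ->
    \int[nu e]_x (f : borel M -> R) x @[e --> 0^'+] -->
    \int[muS]_x (f : borel M -> R) x.
  (* The induced measure is tested against compactly supported functions only. Multiplying by the
     cutoff changes no integral, since all measures involved are concentrated on [K]. *)
  move=> cf; pose h x := f x * chi x.
  have ch : continuous h by move=> x; apply: cvgM; [exact: cf|exact: cchi].
  have sh : compact_support h.
    apply: (subclosed_compact _ supp_chi); first exact: closed_closure.
    apply: closure_subset => x /=; apply: contra_neq => chi0.
    by rewrite /h chi0 mulr0.
  have fh x : K x -> f x = h x by move=> Kx; rewrite /h chi1// mulr1.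
  rewrite (concentrated_Rintegral_eq cK clK mu1 muK cf ch fh).
  have := muS_lim h ch sh; rewrite muSE// => /fine_cvg; apply: cvg_trans.
  apply: near_eq_cvg; near=> e.
  have [nu1 nuK] : (nu e setT <= 1)%E /\ nu e (~` K) = 0%E by near: e.
  rewrite (concentrated_Rintegral_eq cK clK nu1 nuK cf ch fh) /= /Rintegral.
  by have -> : tube_measure X omega S e = nu e by near: e.
have E_cvg := energy_cvg cp cK clK nuP mu1 muK cvg_f.
have cpot := potential_continuous cp cK clK.
have -> : H_limit S muS p t =
    (\int[muS]_y (potential (p t) muS : borel M -> R) y)%:E.
  rewrite -(muSE _ (cpot _ mu1 muK)) /H_limit; apply: eq_integral => y _.
  exact: muSE (section_continuous cp (y := y)).
(* For small [e] the extended-real double integral is the real energy of [nu e]: both integrands are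
   continuous, hence integrable for a finite measure concentrated on [K]. *)
apply: (@cvg_trans _ ((fun e => (\int[nu e]_y
    (potential (p t) (nu e) : borel M -> R) y)%:E) @ 0^'+)).
  apply: near_eq_cvg; near=> e.
  have [nu1 nuK] : (nu e setT <= 1)%E /\ nu e (~` K) = 0%E by near: e.
  rewrite /H_tube; have -> : tube_measure X omega S e = nu e by near: e.
  rewrite -(concentrated_integralE cK clK nu1 nuK (cpot _ nu1 nuK)).
  apply: eq_integral => y _; apply/esym.
  exact: (concentrated_integralE cK clK nu1 nuK
    (section_continuous cp (y := y))).
by apply: cvg_EFin; [near=> e|exact: E_cvg].
Unshelve. all: by end_near. Qed.
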